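(* Let $p\ge 2$ be a prime and let $1\le m\le k$ be integers. Any set of conjugacy classes of $(p^{-k},p^{m})$ locally scaling maps of $\mathbb{Z}_p$ has a finite cardinality $C(m,k)$, and $C(m,k)\ge k-m+1$. Moreover, $C(m,k)=k-m+1$ if and only if $m=k$.
   Context: $\mathbb{Z}_p$ is the ring of $p$-adic integers with the $p$-adic norm $\|\cdot\|_p$ (normalized so that $\|p\|_p=p^{-1}$). A map $f:\mathbb{Z}_p\to\mathbb{Z}_p$ is $(p^{-k},p^m)$ locally scaling if for all $x,y\in\mathbb{Z}_p$ with $\|x-y\|_p\le p^{-k}$ one has $\|f(x)-f(y)\|_p=p^m\|x-y\|_p$. Two maps $f,g:\mathbb{Z}_p\to\mathbb{Z}_p$ are topologically conjugate if there is a homeomorphism $h$ of $\mathbb{Z}_p$ with $f\circ h=h\circ g$. A set of conjugacy classes of $(p^{-k},p^m)$ locally scaling maps is a set $S(m,k)$ of $(p^{-k},p^m)$ locally scaling maps $\mathbb{Z}_p\to\mathbb{Z}_p$ such that every $(p^{-k},p^m)$ locally scaling map is topologically conjugate to some element of $S(m,k)$ and any two different elements of $S(m,k)$ are not topologically conjugate. All such sets have the same cardinality, denoted $C(m,k)$. *)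

(* Defs.v *)
From HB Require Import structures.
From mathcomp Require Import all_boot all_order all_algebra.
From mathcomp Require Import all_classical.
From mathcomp Require Import topology.

Set Implicit Arguments.
Unset Strict Implicit.
Unset Printing Implicit Defensive.

Import Order.TTheory GRing.Theory Num.Theory.

Local Open Scope classical_set_scope.
Local Open Scope ring_scope.

(* The ring of p-adic integers, as the inverse limit of the rings Z/p^n.      *)
(* An element is the sequence of its residues x_n mod p^n; coherence in the   *)
(* form x_n = x_{n+1} mod p^n also forces x_n to be the canonical             *)
(* representative, in [0, p^n).                                               *)
Definition coherent (p : nat) (x : nat -> int) :=
  forall n, x n = (x n.+1 %% p%:Z ^+ n)%Z.

Record padic_int (p : nat) (p_pr : prime p) := PadicInt {
  residue :> nat -> int;
  residueP : `[< coherent p residue >] }.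

HB.instance Definition _ p (p_pr : prime p) :=
  [isSub for @residue p p_pr].
HB.instance Definition _ p (p_pr : prime p) :=
  [Choice of padic_int p_pr by <:].

Section Ring.
Variables (p : nat) (p_pr : prime p).
Local Notation Zp := (padic_int p_pr).
Implicit Types x y z : Zp.

Lemma padicP x y : x =1 y -> x = y.
Proof. by move=> xy; apply/val_inj/funext. Qed.

Lemma padic_mod x n : (x n %% p%:Z ^+ n)%Z = x n.
Proof. by have /asboolP/(_ n) := residueP x; move=> ->; rewrite modz_mod. Qed.

Lemma padic_modS x n : (x n.+1 %% p%:Z ^+ n)%Z = x n.
Proof. by have /asboolP/(_ n) := residueP x. Qed.

Lemma modz_expS (a : int) n :
  ((a %% p%:Z ^+ n.+1)%Z %% p%:Z ^+ n)%Z = (a %% p%:Z ^+ n)%Z.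
Proof.
by rewrite [in RHS](divz_eq a (p%:Z ^+ n.+1)) {3}exprS mulrA modzMDl.
Qed.

Definition reduce (f : nat -> int) n := (f n %% p%:Z ^+ n)%Z.

Lemma reduce_coherent (f : nat -> int) :
  (forall n, (f n.+1 = f n %[mod p%:Z ^+ n])%Z) -> `[< coherent p (reduce f) >].
Proof. by move=> ff; apply/asboolP => n; rewrite /reduce modz_expS ff. Qed.

Fact padic_add_subproof x y :
  `[< coherent p (reduce (fun n => x n + y n)) >].
Proof. by apply: reduce_coherent => n; rewrite -modzDm !padic_modS. Qed.
Fact padic_opp_subproof x : `[< coherent p (reduce (fun n => - x n)) >].
Proof. by apply: reduce_coherent => n; rewrite -modzNm !padic_modS. Qed.
Fact padic_mul_subproof x y :
  `[< coherent p (reduce (fun n => x n * y n)) >].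
Proof. by apply: reduce_coherent => n; rewrite -modzMm !padic_modS. Qed.
Fact padic_cst_subproof (a : int) : `[< coherent p (reduce (fun=> a)) >].
Proof. exact: reduce_coherent. Qed.

Definition padic_add x y : Zp := PadicInt p_pr (padic_add_subproof x y).
Definition padic_opp x : Zp := PadicInt p_pr (padic_opp_subproof x).
Definition padic_mul x y : Zp := PadicInt p_pr (padic_mul_subproof x y).
Definition padic_of_int (a : int) : Zp := PadicInt p_pr (padic_cst_subproof a).

Fact padic_addA : associative padic_add.
Proof.
move=> x y z; apply: padicP => n /=.
by rewrite /reduce /= /reduce modzDmr modzDml addrA.
Qed.
Fact padic_addC : commutative padic_add.
Proof.
move=> x y; apply: padicP => n /=.
by rewrite /reduce addrC.
Qed.
Fact padic_add0 : left_id (padic_of_int 0) padic_add.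
Proof.
move=> x; apply: padicP => n /=.
by rewrite /reduce /= /reduce modzDml add0r padic_mod.
Qed.
Fact padic_addN : left_inverse (padic_of_int 0) padic_opp padic_add.
Proof.
move=> x; apply: padicP => n /=.
by rewrite /reduce /= /reduce modzDml addNr.
Qed.

HB.instance Definition _ := GRing.isZmodule.Build Zp
  padic_addA padic_addC padic_add0 padic_addN.

Fact padic_mulA : associative padic_mul.
Proof.
move=> x y z; apply: padicP => n /=.
by rewrite /reduce /= /reduce modzMmr modzMml mulrA.
Qed.
Fact padic_mulC : commutative padic_mul.
Proof.
move=> x y; apply: padicP => n /=.
by rewrite /reduce mulrC.
Qed.
Fact padic_mul1 : left_id (padic_of_int 1) padic_mul.
Proof.
move=> x; apply: padicP => n /=.
by rewrite /reduce /= /reduce modzMml mul1r padic_mod.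
Qed.
Fact padic_mulD : left_distributive padic_mul +%R.
Proof.
move=> x y z; apply: padicP => n /=.
by rewrite /reduce /= /reduce modzMml modzDm mulrDl.
Qed.
Fact padic_1neq0 : padic_of_int 1 != 0.
Proof.
apply/eqP => /(congr1 (fun x : Zp => x 1)) /=; rewrite /reduce mod0z expr1.
by rewrite modz_small // ltz_nat prime_gt1.
Qed.

HB.instance Definition _ := GRing.Zmodule_isComNzRing.Build Zp
  padic_mulA padic_mulC padic_mul1 padic_mulD padic_1neq0.

Lemma padicDE x y n : (x + y) n = ((x n + y n) %% p%:Z ^+ n)%Z.
Proof. by []. Qed.
Lemma padicNE x n : (- x) n = ((- x n) %% p%:Z ^+ n)%Z.
Proof. by []. Qed.
Lemma padicME x y n : (x * y) n = ((x n * y n) %% p%:Z ^+ n)%Z.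
Proof. by []. Qed.
Lemma padic0E n : (0 : Zp) n = 0.
Proof. by rewrite /= /reduce mod0z. Qed.
Lemma padic_natE a n : (a%:R : Zp) n = (a%:Z %% p%:Z ^+ n)%Z.
Proof.
elim: a => [|a IH]; first by rewrite padic0E mod0z.
by rewrite mulrS padicDE IH /= /reduce modzDm -PoszD.
Qed.

Lemma padic_at0 x : x 0 = 0.
Proof. by rewrite -padic_modS expr0 modz1. Qed.

(* p^n divides x iff x n = 0, so the p-adic valuation of x != 0 is the least  *)
(* n such that x n.+1 != 0. The norm takes its values in Q.                   *)
Definition padic_norm x : rat :=
  if pselect (exists n, x n.+1 != 0) is left x_neq0
  then p%:R ^- (ex_minn x_neq0) else 0.

Let pgt0 : 0 < p%:R :> rat. Proof. by rewrite ltr0n prime_gt0. Qed.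
Let pgt1 : 1 < p%:R :> rat. Proof. by rewrite ltr1n prime_gt1. Qed.

Lemma padic_eq0_le x i n : (i <= n)%N -> x n = 0 -> x i = 0.
Proof.
elim: n => [|n IH]; first by rewrite leqn0 => /eqP->.
rewrite leq_eqVlt => /orP[/eqP->//|]; rewrite ltnS => /IH{}IH xn.
by apply: IH; rewrite -padic_modS xn mod0z.
Qed.

Lemma padic_norm_le x n : (padic_norm x <= p%:R ^- n) = (x n == 0).
Proof.
rewrite /padic_norm; case: pselect => [nz|z].
  case: ex_minnP => v xv vmin.
  rewrite lef_pV2 ?posrE ?exprn_gt0// ler_eXn2l//.
  apply/idP/eqP => [nv|xn].
    case: n nv => [|n] nv; first exact: padic_at0.
    by apply/eqP; apply: contraTT nv => /vmin; rewrite -ltnNge.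
  rewrite leqNgt; apply: contra xv => vn.
  by apply/eqP; apply: padic_eq0_le xn.
rewrite invr_ge0 exprn_ge0 ?ltW//; apply/esym; case: n => [|n].
  by rewrite padic_at0.
by apply: contra_notT z => xn; exists n.
Qed.

Lemma padic_norm_ge0 x : 0 <= padic_norm x.
Proof.
by rewrite /padic_norm; case: pselect => // nz; rewrite invr_ge0 exprn_ge0 ?ltW.
Qed.

Lemma padic_norm_eq0 x : padic_norm x = 0 -> x = 0.
Proof.
move=> x0; apply: padicP => n; apply/eqP.
by rewrite padic0E -padic_norm_le x0 invr_ge0 exprn_ge0 ?ltW.
Qed.

Lemma padic_norm0 : padic_norm 0 = 0.
Proof.
rewrite /padic_norm; case: pselect => // nz; exfalso.
by case: nz => n; rewrite padic0E eqxx.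
Qed.

Lemma padic_norm_val x : x = 0 \/ exists v, padic_norm x = p%:R ^- v.
Proof.
rewrite /padic_norm; case: pselect => [nz|z].
  by right; exists (ex_minn nz).
left; apply: padicP => -[|n]; rewrite padic0E ?padic_at0//.
by apply/eqP; apply: contra_notT z => ?; exists n.
Qed.

Lemma padic_norm_mono x y :
  (forall n, y n = 0 -> x n = 0) -> padic_norm x <= padic_norm y.
Proof.
move=> yx; case: (padic_norm_val y) => [y0|[v yv]].
  have -> : x = 0 by apply: padicP => n; rewrite padic0E yx// y0 padic0E.
  by rewrite padic_norm0 padic_norm_ge0.
by rewrite yv padic_norm_le yx//; apply/eqP; rewrite -padic_norm_le yv.
Qed.

Lemma padic_normN x : padic_norm (- x) = padic_norm x.
Proof.
have H y : padic_norm (- y) <= padic_norm y.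
  by apply: padic_norm_mono => n yn; rewrite padicNE yn oppr0 mod0z.
by apply/eqP; rewrite eq_le H /=; have := H (- x); rewrite opprK.
Qed.

Lemma padic_normD x y :
  padic_norm (x + y) <= Num.max (padic_norm x) (padic_norm y).
Proof.
have H a b : padic_norm a <= padic_norm b -> padic_norm (a + b) <= padic_norm b.
  move=> ab; case: (padic_norm_val b) => [b0|[v bv]].
    by move: ab; rewrite b0 addr0.
  have bv0 : b v = 0 by apply/eqP; rewrite -padic_norm_le bv.
  have av0 : a v = 0 by apply/eqP; rewrite -padic_norm_le -bv.
  by rewrite bv padic_norm_le padicDE av0 bv0 mod0z.
rewrite le_max; case/orP: (le_total (padic_norm x) (padic_norm y)) => /H xy.
  by rewrite xy orbT.
by rewrite addrC xy.
Qed.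

Lemma padic_norm_p : padic_norm p%:R = p%:R^-1.
Proof.
apply/eqP; rewrite eq_le -[_^-1]/(p%:R ^- 1) padic_norm_le padic_natE.
rewrite expr1 modzz eqxx /= /padic_norm.
have p2 : (p%:R : Zp) 2 != 0.
  rewrite padic_natE modz_small.
    by rewrite -lt0n prime_gt0.
  by rewrite /= expr2 -PoszM ltz_nat ltn_Pmull ?prime_gt0 ?prime_gt1.
case: pselect => [nz|[]]; last by exists 1.
case: ex_minnP => v _ /(_ _ p2) v1.
by rewrite lef_pV2 ?posrE ?exprn_gt0// ler_eXn2l.
Qed.

Definition padic_dist x y := padic_norm (x - y).

Fact padic_distxx x : padic_dist x x = 0.
Proof. by rewrite /padic_dist subrr padic_norm0. Qed.
Fact padic_dist_pos x y : padic_dist x y = 0 -> x = y.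
Proof. by move/padic_norm_eq0/eqP; rewrite subr_eq0 => /eqP. Qed.
Fact padic_dist_sym x y : padic_dist x y = padic_dist y x.
Proof. by rewrite /padic_dist -padic_normN opprB. Qed.
Fact padic_dist_triangle y x z :
  padic_dist x z <= padic_dist x y + padic_dist y z.
Proof.
rewrite /padic_dist -(subrKA y x); apply: le_trans (padic_normD _ _) _.
by rewrite ge_max lerDl lerDr !padic_norm_ge0.
Qed.

HB.instance Definition _ := isMetric.Build rat Zp
  padic_distxx padic_dist_pos padic_dist_sym padic_dist_triangle.

End Ring.

Definition homeomorphism (T U : topologicalType) (h : T -> U) :=
  continuous h /\
  exists g : U -> T, [/\ cancel h g, cancel g h & continuous g].

Definition topologically_conjugate (T : topologicalType) (f g : T -> T) :=
  exists h : T -> T, homeomorphism h /\ f \o h = h \o g.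

(* f is (p^-k, p^m) locally scaling *)
Definition locally_scaling (p : nat) (p_pr : prime p) (m k : nat)
    (f : padic_int p_pr -> padic_int p_pr) :=
  forall x y, padic_norm (x - y) <= p%:R ^- k ->
    padic_norm (f x - f y) = p%:R ^+ m * padic_norm (x - y).

Definition set_of_conjugacy_classes (p : nat) (p_pr : prime p) (m k : nat)
    (S : set (padic_int p_pr -> padic_int p_pr)) :=
  [/\ S `<=` locally_scaling m k,
      forall f, locally_scaling m k f ->
        exists2 g, S g & topologically_conjugate f g &
      forall f g, S f -> S g -> f <> g -> ~ topologically_conjugate f g].

(* Main.v *)
(* A locally scaling map f sends each residue class mod p^k bijectively onto
   a class mod p^(k - m), and it is expanding because m >= 1. A point is thus
   determined by its itinerary (f^i(x) mod p^k)_i, and f is determined up to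
   conjugacy by the finite map sending a mod p^k to f(a) mod p^(k - m): x is
   sent to the point which has under f the itinerary of x under g. So C(m, k)
   is finite, and C(k, k) = 1. If m < k, each class a mod p^k may be given
   one fixed point or none, independently. The number of fixed points, a
   conjugacy invariant, takes all values from 0 to p^k, whence
   C(m, k) > p^k >= k + 1 > k - m + 1. *)

Require Import Defs.
From mathcomp Require Import all_boot all_order all_algebra.
From mathcomp Require Import all_classical.
From mathcomp Require Import topology.

Set Implicit Arguments.
Unset Strict Implicit.
Unset Printing Implicit Defensive.

Import Order.TTheory GRing.Theory Num.Theory.

Local Open Scope classical_set_scope.
Local Open Scope card_scope.
Local Open Scope ring_scope.

(** Choice extracts from [r] a map from [A] to [B], injective by the second hypothesis. Both the
    upper and the lower bounds on the number of classes rest on this. *)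
Lemma card_le_rel (T U : Type) (A : set T) (B : set U) (r : T -> U -> Prop) :
    (forall a, A a -> exists2 b, B b & r a b) ->
    (forall a a' b, A a -> A a' -> r a b -> r a' b -> a = a') ->
  A #<= B.
Proof.
move=> AB r_inj; have [->|/set0P[a0 /AB[b0 _ _]]] := eqVneq A set0.
  exact: card_ge0.
have /choice[f fP] a : exists b, A a -> B b /\ r a b.
  by have [/AB[b]|] := pselect (A a); [exists b|exists b0].
have /injfunPex/unsquash F : exists2 f : T -> U, set_fun A B f & set_inj A f.
  exists f => [a /fP[]//|a a' /set_mem Aa /set_mem Aa' ff].
  apply: (r_inj a a' (f a)) => //; first by case: (fP a Aa).
  by rewrite ff; case: (fP a' Aa').
exact: inj_card_le F.
Qed.

(** * Symmetry and transitivity of conjugacy *)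

Section Homeomorphism.
Variable T : topologicalType.

Lemma topologically_conjugate_sym (f g : T -> T) :
  topologically_conjugate f g -> topologically_conjugate g f.
Proof.
move=> [h [[h_cont [h' [hK h'K h'_cont]]] fh]]; exists h'; split.
  by split=> //; exists h.
apply/funext => x /=; apply: (can_inj hK).
by rewrite h'K -[LHS]/((h \o g) (h' x)) -fh /= h'K.
Qed.

Lemma topologically_conjugate_trans (g f e : T -> T) :
  topologically_conjugate f g -> topologically_conjugate g e ->
  topologically_conjugate f e.
Proof.
move=> [h [[h_cont [h' [hK h'K h'_cont]]] fh]].
move=> [u [[u_cont [u' [uK u'K u'_cont]]] gu]]; exists (h \o u); split.
  split.
    by move=> x; apply: continuous_comp; [exact: u_cont|exact: h_cont].
  exists (u' \o h'); split; [exact: can_comp|exact: can_comp|].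
  by move=> x; apply: continuous_comp; [exact: h'_cont|exact: u'_cont].
by rewrite compA fh -compA gu.
Qed.

End Homeomorphism.

(** * Residues and the local scaling condition *)

Lemma PoszX (a n : nat) : Posz (a ^ n) = a%:Z ^+ n.
Proof. by rewrite -natz natrX natz. Qed.

(** Division by [q ^+ m] drops the [m] lowest digits in base [q], so [n + m] digits of [a] fix [n]
    digits of the quotient. *)
Lemma divz_modz_exp (a q : int) (m n : nat) : q != 0 ->
  (((a %% q ^+ (n + m))%Z %/ q ^+ m)%Z = (a %/ q ^+ m)%Z %[mod q ^+ n])%Z.
Proof.
move=> q0; rewrite [in RHS](divz_eq a (q ^+ (n + m))) exprD mulrA.
by rewrite divzMDl ?expf_neq0// modzMDl.
Qed.

Lemma modz_modz_exp (a q : int) (n i : nat) :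
  ((a %% q ^+ (n + i))%Z %% q ^+ n)%Z = (a %% q ^+ n)%Z.
Proof.
by rewrite [in RHS](divz_eq a (q ^+ (n + i))) addnC exprD mulrA modzMDl.
Qed.

Section Padic.
Variables (p : nat) (p_pr : prime p).
Local Notation Zp := (padic_int p_pr).
Implicit Types (x y z : Zp) (f g : Zp -> Zp).

Let p_neq0 : p%:Z != 0. Proof. by rewrite -lt0n prime_gt0. Qed.
Let p_gt0 : 0 < p%:Z. Proof. by rewrite ltz_nat prime_gt0. Qed.
Let pR_gt0 : 0 < p%:R :> rat. Proof. by rewrite ltr0n prime_gt0. Qed.
Let pR_gt1 : 1 < p%:R :> rat. Proof. by rewrite ltr1n prime_gt1. Qed.

Lemma residue_ge0 x n : 0 <= x n.
Proof. by rewrite -padic_mod modz_ge0 ?expf_neq0. Qed.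

Lemma residue_lt x n : x n < p%:Z ^+ n.
Proof. by rewrite -padic_mod ltz_pmod ?exprn_gt0. Qed.

Lemma residue_mod x n i : (x (n + i)%N %% p%:Z ^+ n)%Z = x n.
Proof.
elim: i => [|i IH]; first by rewrite addn0 padic_mod.
by rewrite -{}IH -[in RHS]padic_modS addnS modz_modz_exp.
Qed.

Lemma eq_residue_le x y i n : (i <= n)%N -> x n = y n -> x i = y i.
Proof.
by move=> /subnKC <- xy; rewrite -(residue_mod x i (n - i)) xy residue_mod.
Qed.

Lemma subr_residue_eq0 x y n : ((x - y) n == 0) = (x n == y n).
Proof.
rewrite padicDE padicNE modzDmr (sameP eqP dvdz_mod0P) -eqz_mod_dvd.
by rewrite !padic_mod.
Qed.

Lemma padic_dist_le x y n :
  (padic_norm (x - y) <= p%:R ^- n) = (x n == y n).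
Proof. by rewrite padic_norm_le subr_residue_eq0. Qed.

(** The scaling law read on digits: [f] loses exactly [m] digits of agreement. As [m <= k],
    multiplying a nonzero norm [p^-v] with [v >= k] by [p^m] gives [p^-(v - m)], which residues can
    detect. *)
Lemma locally_scalingP (m k : nat) f : (m <= k)%N ->
  locally_scaling m k f <->
  (forall x y, x k = y k ->
    forall n, f x n = f y n <-> x (n + m)%N = y (n + m)%N).
Proof.
move=> mk; split=> [fs x y xy n|fs x y].
  have := fs x y; rewrite padic_dist_le xy eqxx => /(_ isT) fxy.
  rewrite (rwP eqP) -padic_dist_le fxy -ler_pdivlMl ?exprn_gt0//.
  by rewrite -invfM -exprD padic_dist_le addnC -(rwP eqP).
rewrite padic_dist_le => /eqP /[dup] xyk /fs{}fs.
have [xy|[v xyv]] := padic_norm_val (x - y).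
  have -> : f x = f y by apply: padicP => n; apply/fs; move/subr0_eq: xy => ->.
  by rewrite xy subrr padic_norm0 mulr0.
have mv : (m <= v)%N.
  apply: leq_trans mk _.
  rewrite -(ler_eXn2l pR_gt1) -lef_pV2 ?posrE ?exprn_gt0//.
  by rewrite -xyv padic_dist_le xyk.
have -> : p%:R ^+ m * padic_norm (x - y) = p%:R ^- (v - m) :> rat.
  rewrite xyv -{1}(subnK mv) exprD invfM mulrCA divff ?mulr1//.
  by rewrite expf_neq0// gt_eqF.
apply/eqP; rewrite eq_le padic_dist_le; apply/andP; split.
  by apply/eqP/fs/eqP; rewrite subnK// -padic_dist_le xyv.
(* A strictly smaller norm would be at most [p^-(v - m + 1)]; then [x] and [y] would agree modulo
   [p^(v + 1)], against the choice of [v]. *)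
rewrite leNgt; apply/negP => lt_v.
suff : x v.+1 == y v.+1.
  by rewrite -padic_dist_le xyv lef_pV2 ?posrE ?exprn_gt0// ler_eXn2l// ltnn.
rewrite -(subnK mv) -addSn; apply/eqP/fs/eqP; rewrite -padic_dist_le.
have [->|[w wv]] := padic_norm_val (f x - f y).
  by rewrite padic_norm0 invr_ge0 exprn_ge0// ltW.
move: lt_v; rewrite wv ltf_pV2 ?posrE ?exprn_gt0// ltr_eXn2l// => lt_v.
by rewrite lef_pV2 ?posrE ?exprn_gt0// ler_eXn2l.
Qed.

Lemma residue_continuous (h : Zp -> Zp) :
  (forall n, exists i, forall x y, x i = y i -> h x n = h y n) -> continuous h.
Proof.
move=> h_unif x; apply/(@cvg_ballP _ _ _ _ (nbhs_filter x)) => e e0.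
have [n ne] : exists n, p%:R ^- n < e.
  exists (Num.bound e^-1); rewrite invf_plt ?posrE ?exprn_gt0//.
  apply: lt_trans (archi_boundP _) _; first by rewrite invr_ge0 ltW.
  by rewrite -natrX ltr_nat ltn_expl ?prime_gt1.
have [i hi] := h_unif n.
apply/nbhs_ballP; exists (p%:R ^- i) => [|y].
  by rewrite /= invr_gt0 exprn_gt0.
rewrite !ballEmdist /= => /ltW; rewrite padic_dist_le => /eqP /hi /eqP.
by rewrite -padic_dist_le => /le_lt_trans; apply.
Qed.

(** * Branches and itineraries *)

Section Shadowing.
Variables m k : nat.
Hypotheses (m_ge1 : (1 <= m)%N) (m_le_k : (m <= k)%N).

Lemma locally_scaling_residue f x y n :
  locally_scaling m k f -> x k = y k ->
  f x n = f y n <-> x (n + m)%N = y (n + m)%N.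
Proof. by move=> /(locally_scalingP f m_le_k) fs xy; apply: fs. Qed.

(** A counting argument. The [p^n] points [x + p^k j] differ modulo [p^(n + k)], so their images
    differ modulo [p^(n + k - m)], while all are congruent to [z] modulo [p^(k - m)]. Dividing the
    differences by [p^(k - m)] gives an injection [d] of a set of [p^n] elements into itself, hence
    a bijection, and the index sent to 0 is the one sought. *)
Lemma locally_scaling_onto f x z n : locally_scaling m k f ->
  f x (k - m)%N = z (k - m)%N -> exists2 y : Zp, y k = x k & f y n = z n.
Proof.
move=> fs fxz; pose y (j : 'I_(p ^ n)) := x + (p ^ k * j)%:R.
have yk j : y j k = x k.
  rewrite padicDE padic_natE modzDmr PoszM PoszX.
  by rewrite mulrC addrC modzMDl padic_mod.
have y_inj i j : y i (n + k)%N = y j (n + k)%N -> i = j.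
  move/eqP; rewrite -subr_residue_eq0 /y opprD addrACA subrr add0r.
  rewrite subr_residue_eq0 !padic_natE => /eqP.
  have small (l : 'I_(p ^ n)) :
      ((p ^ k * l)%N%:Z %% p%:Z ^+ (n + k))%Z = (p ^ k * l)%N.
    rewrite modz_small// -PoszX ltz_nat addnC expnD ltn_pmul2l ?ltn_ord//.
    by rewrite expn_gt0 prime_gt0.
  rewrite !small => -[/eqP]; rewrite eqn_pmul2l ?expn_gt0 ?prime_gt0// => /eqP.
  exact: val_inj.
pose w j := f (y j) - z.
have w0 j : w j (k - m)%N = 0.
  apply/eqP; rewrite subr_residue_eq0 -fxz; apply/eqP.
  by apply/(locally_scaling_residue _ fs) => //; rewrite subnK.
have wE j : w j (n + (k - m))%N =
    (w j (n + (k - m))%N %/ p%:Z ^+ (k - m))%Z * p%:Z ^+ (k - m).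
  rewrite [LHS](divz_eq _ (p%:Z ^+ (k - m))).
  by rewrite [(n + (k - m))%N]addnC residue_mod w0 addr0.
have w_ge0 j : 0 <= (w j (n + (k - m))%N %/ p%:Z ^+ (k - m))%Z.
  by rewrite divz_ge0 ?exprn_gt0 ?residue_ge0.
have w_lt j : (`|(w j (n + (k - m))%N %/ p%:Z ^+ (k - m))%Z| < p ^ n)%N.
  rewrite -ltz_nat gez0_abs//.
  by rewrite ltz_divLR ?exprn_gt0// PoszX -exprD residue_lt.
pose d j := Ordinal (w_lt j).
have d_inj : injective d.
  move=> i j /(congr1 val) /= dij; apply: y_inj.
  have <- : (n + (k - m) + m)%N = (n + k)%N by rewrite -addnA subnK.
  apply/(locally_scaling_residue _ fs); first by rewrite !yk.
  apply/eqP; rewrite -subr_residue_eq0.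
  have -> : f (y i) - f (y j) = w i - w j by rewrite /w opprB addrA subrK.
  rewrite subr_residue_eq0 wE (wE j); apply/eqP; congr (_ * _).
  by rewrite -[LHS]gez0_abs ?w_ge0// -[RHS]gez0_abs ?w_ge0// dij.
have [d' _ d'K] := injF_bij d_inj.
have pn_gt0 : (0 < p ^ n)%N by rewrite expn_gt0 prime_gt0.
exists (y (d' (Ordinal pn_gt0))) => //.
have /(congr1 val) /= /eqP := d'K (Ordinal pn_gt0).
rewrite absz_eq0 => /eqP d0; apply/eqP; rewrite -subr_residue_eq0.
by apply/eqP; apply: padic_eq0_le (leq_addr (k - m) n) _; rewrite wE d0 mul0r.
Qed.

(** Each further term of the itinerary is worth [m] more digits of the starting point. *)
Lemma iter_residue f x y n : locally_scaling m k f ->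
  (forall i, (i <= n)%N -> iter i f x k = iter i f y k) <->
  x (k + n * m)%N = y (k + n * m)%N.
Proof.
move=> fs; elim: n x y => [|n IH] x y.
  rewrite mul0n addn0; split=> [/(_ 0 isT)//|xy i].
  by rewrite leqn0 => /eqP->.
rewrite mulSn [(m + _)%N]addnC addnA; split=> [xy|xy].
  apply/(locally_scaling_residue _ fs); first exact: (xy 0).
  by apply/IH => i i_n; rewrite -!iterSr; apply: xy.
have xyk : x k = y k by apply: eq_residue_le xy; rewrite -addnA leq_addr.
case=> [//|i] i_n; rewrite !iterSr; apply/IH: i i_n.
exact/(locally_scaling_residue _ fs).
Qed.

Lemma leq_depth n : (n <= k + n * m)%N.
Proof. by rewrite (leq_trans (leq_pmulr n m_ge1))// leq_addl. Qed.

Lemma iter_residue_inj f x y : locally_scaling m k f ->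
  (forall i, iter i f x k = iter i f y k) -> x = y.
Proof.
move=> fs xy; apply: padicP => n; apply: eq_residue_le (leq_depth n) _.
by apply/(iter_residue _ _ _ fs) => i _.
Qed.

(** * Shadowing and the conjugacy built from it *)

Section Conjugacy.
Variables f g : Zp -> Zp.
Hypotheses (fs : locally_scaling m k f) (gs : locally_scaling m k g).
Hypothesis fg : forall x, f x (k - m)%N = g x (k - m)%N.

(** Induction by pullback: a point [y] that shadows [g x] for [n] steps agrees with [g x], hence
    with [f x], modulo [p^(k - m)]. It therefore has an approximate preimage under [f] in the class
    of [x], and precision [p^(k + n * m)] preserves the prefix. *)
Lemma shadowing_prefix n x :
  exists y, forall i, (i <= n)%N -> iter i f y k = iter i g x k.
Proof.
elim: n x => [|n IH] x; first by exists x => i; rewrite leqn0 => /eqP->.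
have [y yP] := IH (g x).
have [|u uk fu] := @locally_scaling_onto f x y (k + n * m) fs.
  by rewrite fg; apply/esym/eq_residue_le/(yP 0); rewrite // leq_subr.
exists u; case=> [//|i] i_n; rewrite !iterSr -yP//.
by have /(iter_residue _ _ _ fs) -> := fu.
Qed.

(** A diagonal limit: the shadows [y n] and [y n.+1] share a prefix that fixes at least [n] digits,
    so the residues [y n n] are coherent. *)
Lemma shadowing x : exists y, forall i, iter i f y k = iter i g x k.
Proof.
have /choice[y yP] n := shadowing_prefix n x.
have y_coh : `[< coherent p (fun n => y n n) >].
  apply/asboolP => n; rewrite padic_modS; apply: eq_residue_le (leq_depth n) _.
  apply/(iter_residue _ _ _ fs) => i i_n; rewrite !yP//; exact: leq_trans i_n _.
exists (PadicInt p_pr y_coh) => i.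
(* At depth [k + i * m] the limit has by definition the residue of [y (k + i * m)], which is enough
   for the terms up to [i]. *)
rewrite -(yP (k + i * m)%N) ?leq_depth//.
exact: (iffRL (iter_residue (PadicInt p_pr y_coh) (y (k + i * m)%N) i fs)).
Qed.

End Conjugacy.

Lemma eq_residue_topologically_conjugate f g :
    locally_scaling m k f -> locally_scaling m k g ->
    (forall x, f x (k - m)%N = g x (k - m)%N) ->
  topologically_conjugate f g.
Proof.
move=> fs gs fg.
have /choice[h hP] := shadowing fs fg.
have /choice[h' h'P] := shadowing gs (fun x => esym (fg x)).
(* Digits of [x] fix a prefix of its itinerary under [g1], and that prefix fixes digits of [h1 x].
   The algebraic identities below compare itineraries. *)
have shadow_cont f1 g1 h1 : locally_scaling m k f1 -> locally_scaling m k g1 ->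
    (forall x i, iter i f1 (h1 x) k = iter i g1 x k) -> continuous h1.
  move=> f1s g1s h1P; apply: residue_continuous => n.
  exists (k + n * m)%N => x y.
  move=> /(iter_residue _ _ _ g1s) xy; apply: eq_residue_le (leq_depth n) _.
  by apply/(iter_residue _ _ _ f1s) => i /xy; rewrite !h1P.
exists h; split; last first.
  apply/funext => x /=; apply: (iter_residue_inj fs) => i.
  by rewrite -iterSr !hP -iterSr.
split; first exact: shadow_cont hP.
exists h'; split; last exact: shadow_cont h'P.
- by move=> x; apply: (iter_residue_inj gs) => i; rewrite h'P hP.
- by move=> x; apply: (iter_residue_inj fs) => i; rewrite hP h'P.
Qed.

End Shadowing.

(** * Sets of conjugacy classes: existence, cardinality, finiteness *)

Section ConjugacyClasses.
Variables m k : nat.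
Implicit Types S : set (Zp -> Zp).

(** Maps that are not conjugate have different representatives in [S]. This compares two sets of
    classes, and bounds their size from below by explicit families. *)
Lemma card_le_conjugacy_classes T (A : set T) (F : T -> Zp -> Zp) S :
    set_of_conjugacy_classes m k S ->
    (forall a, A a -> locally_scaling m k (F a)) ->
    (forall a b, A a -> A b -> topologically_conjugate (F a) (F b) -> a = b) ->
  A #<= S.
Proof.
move=> [_ S_repr _] Fs F_inj.
apply: (@card_le_rel _ _ _ _ (fun a g => topologically_conjugate (F a) g)).
  by move=> a /Fs /S_repr.
move=> a b g Aa Ab ag bg; apply: F_inj => //.
exact/(topologically_conjugate_trans ag)/topologically_conjugate_sym.
Qed.

Lemma card_eq_conjugacy_classes S1 S2 :
  set_of_conjugacy_classes m k S1 -> set_of_conjugacy_classes m k S2 ->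
  S1 #= S2.
Proof.
have le S S' : set_of_conjugacy_classes m k S ->
    set_of_conjugacy_classes m k S' -> S #<= S'.
  move=> [Ss _ S_sep] S'cc.
  apply: (@card_le_conjugacy_classes _ S id _ S'cc) => // f g Sf Sg fg.
  by apply: contrapT => /(S_sep _ _ Sf Sg).
by move=> cc1 cc2; rewrite card_eq_le !le.
Qed.

Lemma conjugacy_classes_exist :
  exists S, set_of_conjugacy_classes m k S.
Proof.
(* [{classic _}] provides the choice structure for [xget]. Its default [id] is not reached for a
   locally scaling [f], since [f] lies in [cls f]. *)
pose cls f := [set g : {classic Zp -> Zp} |
  locally_scaling m k g /\ topologically_conjugate f g].
pose rep f : Zp -> Zp := xget (id : {classic Zp -> Zp}) (cls f).
have repP f : locally_scaling m k f -> cls f (rep f).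
  move=> fs; apply: (@xgetPex _ (id : {classic Zp -> Zp})).
  exists f; split=> //.
  exists id; split=> //; split; first by move=> x; exact: cvg_id.
  by exists id; split=> // x; exact: cvg_id.
exists (rep @` locally_scaling m k); split.
- by move=> _ [f /repP[? _] <-].
- by move=> f fs; exists (rep f); [exists f|case: (repP f fs)].
move=> _ _ [f fs <-] [g gs <-] neq fg; apply: neq.
have [_ ff] := repP f fs; have [_ gg] := repP g gs.
have {ff gg}fg : topologically_conjugate f g.
  apply: topologically_conjugate_trans ff _.
  exact/(topologically_conjugate_trans fg)/topologically_conjugate_sym.
(* The choice depends only on the class as a set, so equal classes give equal representatives. *)
congr (xget _ _); apply/seteqP; split=> e [es].
  have gf := topologically_conjugate_sym fg.
  by split=> //; apply: topologically_conjugate_trans gf _.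
by split=> //; apply: topologically_conjugate_trans fg _.
Qed.

Lemma finite_conjugacy_classes S : (1 <= m <= k)%N ->
  set_of_conjugacy_classes m k S -> finite_set S.
Proof.
move=> /andP[m_ge1 m_le_k] [Ss _ S_sep].
(* The table of [f] modulo [p^(k - m)] on the classes modulo [p^k]. The successor in the codomain
   serves [inord]; all values are below [p^(k - m)], so none is altered. *)
pose code f : {ffun 'I_(p ^ k) -> 'I_(p ^ (k - m)).+1} :=
  [ffun a => inord `|f (val a)%:R (k - m)%N|%N].
apply: (@card_le_finite _ _ S [set: {ffun 'I_(p ^ k) -> 'I_(p ^ (k - m)).+1}]);
  last exact: finite_finset.
apply: (@card_le_rel _ _ _ _ (fun f c => c = code f)) => [f _|f g _ Sf Sg ->].
  by exists (code f).
move=> fg; apply: contrapT => /(S_sep _ _ Sf Sg); apply.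
apply: (eq_residue_topologically_conjugate m_ge1 m_le_k) => [||x];
  do ?exact: Ss.
have xk_lt : (`|x k| < p ^ k)%N.
  by rewrite -ltz_nat gez0_abs ?residue_ge0// PoszX residue_lt.
have xk : x k = (`|x k|%N%:R : Zp) k.
  by rewrite padic_natE gez0_abs ?residue_ge0// padic_mod.
have codeE f1 : locally_scaling m k f1 ->
    code f1 (Ordinal xk_lt) = f1 x (k - m)%N :> int.
  move=> f1s; rewrite ffunE /= inordK.
    rewrite gez0_abs ?residue_ge0//; apply/esym.
    by apply/(locally_scaling_residue m_le_k _ f1s xk); rewrite subnK.
  by rewrite ltnS ltnW// -ltz_nat gez0_abs ?residue_ge0// PoszX residue_lt.
by rewrite -(codeE f (Ss _ Sf)) -(codeE g (Ss _ Sg)) fg.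
Qed.

End ConjugacyClasses.

(** * Maps with prescribed branches *)

Section Dilation.
Variables (m k : nat) (c : int -> int).
Hypothesis m_le_k : (m <= k)%N.

Fact dilation_subproof x :
  `[< coherent p
    (reduce p (fun n => (x (n + m)%N %/ p%:Z ^+ m)%Z + c (x k))) >].
Proof.
apply: reduce_coherent => n; rewrite -(residue_mod x (n + m) 1) addn1 -addSn.
by rewrite -modzDml -[in RHS]modzDml divz_modz_exp.
Qed.

(* On a + p^k Z_p this is the branch a + p^k z |-> phi(a) + p^(k - m) z with
   phi(a) = floor(a / p^m) + c(a), which c adjusts to any prescribed value. *)
Definition dilation x : Zp := PadicInt p_pr (dilation_subproof x).

Lemma dilationE x n :
  dilation x n = (((x (n + m)%N %/ p%:Z ^+ m)%Z + c (x k)) %% p%:Z ^+ n)%Z.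
Proof. by []. Qed.

Lemma dilation_locally_scaling : locally_scaling m k dilation.
Proof.
apply/(locally_scalingP _ m_le_k) => x y xy n; rewrite !dilationE xy.
split=> [/eqP|->//]; rewrite eqz_modDr.
(* The quotients already lie in [[0, p^n)], so their congruence is an equality; the remainders
   modulo [p^m] agree because [m <= k]. *)
have div_small z : ((z (n + m)%N %/ p%:Z ^+ m)%Z %% p%:Z ^+ n)%Z
    = (z (n + m)%N %/ p%:Z ^+ m)%Z.
  rewrite modz_small// divz_ge0 ?exprn_gt0 ?residue_ge0//.
  by rewrite ltz_divLR ?exprn_gt0// -exprD residue_lt.
rewrite !div_small => /eqP xydiv.
rewrite (divz_eq (x _) (p%:Z ^+ m)) xydiv [RHS](divz_eq _ (p%:Z ^+ m)).
by rewrite addnC !residue_mod (eq_residue_le m_le_k xy).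
Qed.

Lemma dilation_residue x n : (n + m <= k)%N ->
  dilation x n = (((x k %/ p%:Z ^+ m)%Z + c (x k)) %% p%:Z ^+ n)%Z.
Proof.
move=> nm_le_k; rewrite dilationE -(residue_mod x (n + m) (k - (n + m))).
by rewrite subnKC// -modzDml divz_modz_exp// modzDml.
Qed.

Lemma dilation_nat (a n : nat) : (a < p ^ k)%N ->
  dilation a%:R n = (((a %/ p%:Z ^+ m)%Z + c a) %% p%:Z ^+ n)%Z.
Proof.
move=> a_lt; rewrite dilationE !padic_natE [(a %% _ ^+ k)%Z]modz_small.
  by rewrite -modzDml divz_modz_exp// modzDml.
by rewrite -PoszX ltz_nat a_lt.
Qed.

End Dilation.

(** * Maps with a prescribed number of fixed points *)

Section FixedPoints.
Variables m k : nat.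
Hypotheses (m_ge1 : (1 <= m)%N) (m_lt_k : (m < k)%N).

(** Here [phi(a) = a] if [a < j], and [phi(a) = a + 1] otherwise. *)
Definition fix_first (j : nat) : Zp -> Zp :=
  dilation m k (fun a => a + (j%:Z <= a)%R%:R - (a %/ p%:Z ^+ m)%Z).

Lemma fix_first_locally_scaling j : locally_scaling m k (fix_first j).
Proof. exact: dilation_locally_scaling (ltnW m_lt_k). Qed.

Lemma fix_first_fixedP j x : (j <= p ^ k)%N ->
  fix_first j x = x <-> exists2 a, (a < j)%N & x = a%:R.
Proof.
move=> j_le; have fix_nat a : (a < j)%N -> fix_first j a%:R = a%:R.
  move=> a_lt; apply: padicP => n.
  rewrite dilation_nat ?(leq_trans a_lt)// addrCA subrr addr0 padic_natE.
  by rewrite lez_nat leqNgt a_lt addr0.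
split=> [fx|[a a_lt ->]]; last exact: fix_nat.
have [a_lt|j_le_a] := ltP (x k) j%:Z.
  have a_ltj : (`|x k| < j)%N by rewrite -ltz_nat gez0_abs ?residue_ge0.
  exists `|x k|%N => //.
  (* Fixed points have constant itineraries, so a class modulo [p^k] contains at most one. *)
  apply: (iter_residue_inj m_ge1 (ltnW m_lt_k) (fix_first_locally_scaling j)).
  move=> i; rewrite !iter_fix ?fix_nat//.
  by rewrite padic_natE gez0_abs ?residue_ge0// padic_mod.
(* On the remaining classes the map adds 1 modulo [p]; this is visible because [m < k] lets [x k]
   determine the image modulo [p]. *)
move/(congr1 (fun z : Zp => z 1)): fx.
rewrite dilation_residue// j_le_a /= addrCA subrr addr0 -modzDml.
have -> : (x k %% p%:Z ^+ 1)%Z = x 1.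
  have /subnKC <- : (1 <= k)%N by exact: leq_ltn_trans m_lt_k.
  exact: residue_mod.
rewrite -[RHS](padic_mod x 1) -[X in _ = (X %% _)%Z]addr0 => /eqP.
rewrite eqz_modDl mod0z modz_small ?expr1 ?ltz_nat ?prime_gt1//.
Qed.

(** A conjugacy injects the fixed points of one map into those of the other; symmetry gives equal
    numbers. *)
Lemma fix_first_conjugate i j : (i <= p ^ k)%N -> (j <= p ^ k)%N ->
  topologically_conjugate (fix_first i) (fix_first j) -> i = j.
Proof.
have natr_inj a b : (a < p ^ k)%N -> (b < p ^ k)%N ->
    a%:R = b%:R :> Zp -> a = b.
  move=> a_lt b_lt /(congr1 (fun z : Zp => z k)); rewrite !padic_natE.
  by rewrite !modz_small -?PoszX ?ltz_nat ?a_lt ?b_lt// => -[].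
have le u v : (u <= p ^ k)%N -> (v <= p ^ k)%N ->
    topologically_conjugate (fix_first u) (fix_first v) -> (v <= u)%N.
  move=> u_le v_le [h [[_ [h' [hK _ _]]] uv]]; rewrite -card_le_II.
  apply: (@card_le_rel _ _ _ _ (fun a b => h a%:R = b%:R)).
    move=> a a_lt.
    have /(fix_first_fixedP _ u_le)[b] : fix_first u (h a%:R) = h a%:R.
      rewrite -[LHS]/((fix_first u \o h) _) uv /=; congr h.
      by apply/fix_first_fixedP => //; exists a.
    by exists b.
  move=> a a' b a_lt a'_lt <- /(can_inj hK)/esym.
  by apply: natr_inj; exact: leq_trans v_le.
move=> i_le j_le ij; apply/eqP; rewrite eqn_leq.
by apply/andP; split; apply: le => //; apply: topologically_conjugate_sym.
Qed.

End FixedPoints.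

End Padic.

(* The count of conjugacy classes *)
Local Close Scope ring_scope.

Theorem theorem15 (p : nat) (p_pr : prime p) (m k : nat)
    (m_ge1 : (1 <= m)%N) (m_le_k : (m <= k)%N) :
  exists C : nat,
    [/\ exists S : set (padic_int p_pr -> padic_int p_pr),
          set_of_conjugacy_classes m k S,
        forall S : set (padic_int p_pr -> padic_int p_pr),
          set_of_conjugacy_classes m k S -> S #= `I_C,
        (k - m + 1 <= C)%N &
        C = (k - m + 1)%N <-> m = k].
Proof.
have [S Scc] := conjugacy_classes_exist p_pr m k.
have /finite_setP[C SC] : finite_set S.
  by apply: finite_conjugacy_classes Scc; rewrite m_ge1.
have S_classes (S' : set (padic_int p_pr -> padic_int p_pr)) :
    set_of_conjugacy_classes m k S' -> S' #= `I_C.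
  by move=> S'cc; apply: card_eq_trans (card_eq_conjugacy_classes S'cc Scc) SC.
exists C; have [mk|m_neq_k] := eqVneq m k.
  suff C1 : C = 1.
    have -> : k - m + 1 = C by rewrite C1 mk subnn.
    by split=> //; exists S.
  apply/eqP; rewrite eqn_leq -!card_le_II -(card_le_eql SC) -(card_le_eqr SC).
  apply/andP; split.
    have [Ss _ S_sep] := Scc.
    apply: (@card_le_rel _ _ _ _ (fun _ _ => True)) => [f _|f g _ Sf Sg _ _].
      by exists 0%N.
    apply: contrapT => /(S_sep _ _ Sf Sg); apply.
    (* For [m = k] the finite data are residues modulo 1, so any two members of [S] are
       conjugate. *)
    apply: (eq_residue_topologically_conjugate m_ge1 m_le_k) => [||x];
  do ?exact: Ss.
    by rewrite mk subnn !padic_at0.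
  apply: (card_le_conjugacy_classes (F := fun=> dilation m k id) Scc).
    by move=> _ _; apply: dilation_locally_scaling.
  by case=> [|?] [|?].
have {m_neq_k m_le_k}m_lt_k : (m < k)%N by rewrite ltn_neqAle m_neq_k.
(* The strict inequality counts the [p^k + 1] values [j = 0, ..., p^k]. *)
have C_gt : (p ^ k < C)%N.
  rewrite -card_le_II -(card_le_eqr SC).
  apply: (card_le_conjugacy_classes (F := @fix_first p p_pr m k) Scc).
    by move=> j _; apply: fix_first_locally_scaling.
  by move=> i j; apply: fix_first_conjugate.
have {C_gt}C_gt : (k - m + 1 < C)%N.
  rewrite addn1; apply: leq_ltn_trans C_gt.
  apply: leq_trans (ltn_expl k (prime_gt1 p_pr)).
  by rewrite ltnS leq_subr.
split=> //; first by exists S.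
  exact: ltnW.
by split=> [Ck|mk]; [rewrite Ck ltnn in C_gt|rewrite mk ltnn in m_lt_k].
Qed.
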